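(* Let $n\ge1$ and $d$ be integers with $|d|\ge2$. The sand dune group $\Sigma(n,d)$ is finite, and the map $c\mapsto (x-1)c$ induces an injective group homomorphism $S(n,d)\to\Sigma(n,d)$, so that $S(n,d)$ is (identified with) a subgroup of $\Sigma(n,d)$. Moreover, for integers $a_1,\dots,a_{n-1}$, the class of $a=\sum_{v=1}^{n-1}a_ve_v$ in $\Sigma(n,d)$ lies in $S(n,d)$ if and only if $\sum_{v=1}^{n-1}v\,a_v\equiv 0\pmod n$.
   Context: In $\mathbb{Q}[x,x^{-1}]/(x^n-1)$ (exponents mod $n$) put $e_v=x^v-1$ and $\epsilon_v=d\,e_v-e_{dv}$. $\mathcal Z_n$ is the $\mathbb{Z}$-span of $e_1,\dots,e_{n-1}$, $\mathcal E_{n,d}$ the $\mathbb{Z}$-span of $\epsilon_1,\dots,\epsilon_{n-1}$, and $\Sigma(n,d)=\mathcal Z_n/\mathcal E_{n,d}$. With $f_v=dx^v-\sum_{i=0}^{d-1}x^{dv+i}$ for $d\ge2$ and $f_v=dx^v+\sum_{i=0}^{|d|-1}x^{d(v+1)+i}$ for $d\le-2$, $S(n,d)=\mathcal Z_n/\langle f_1,\dots,f_{n-1}\rangle_{\mathbb{Z}}$ (isomorphic to the sandpile group of the generalized de Bruijn, resp. Kautz, graph). *)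

(* Defs.v *)
From HB Require Import structures.
From mathcomp Require Import all_boot all_order all_algebra.
From mathcomp Require Import ring.

Set Implicit Arguments.
Unset Strict Implicit.
Unset Printing Implicit Defensive.

Import Order.TTheory GRing.Theory Num.Theory.
Local Open Scope ring_scope.
Local Open Scope quotient_scope.

(* Membership in the Z-span is decidable in a Q-vector space, so that spans
   can be boolean predicates, as the quotient construction requires. *)
Definition zspan (vT : vectType rat) m (s : m.-tuple vT) : {pred vT} :=
  [pred v | dec_Qint_span s v].

Section ZSpan.
Variables (vT : vectType rat) (m : nat) (s : m.-tuple vT).

Lemma zspanP v : reflect (inIntSpan s v) (v \in zspan s).
Proof. by rewrite unfold_in /=; case: dec_Qint_span => h; constructor. Qed.

Fact zspan_zmod_closed : zmod_closed (zspan s).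
Proof.
split=> [|u v /zspanP[a ->] /zspanP[b ->]]; apply/zspanP.
  by exists 0; rewrite big1 // => i _; rewrite ffunE mulr0z.
exists (a - b); rewrite -sumrB; apply: eq_bigr => i _.
by rewrite !ffunE mulrzBr.
Qed.
HB.instance Definition _ :=
  GRing.isZmodClosed.Build vT (zspan s) zspan_zmod_closed.

Lemma mem_zspan v : v \in s -> v \in zspan s.
Proof.
move=> /tnthP[i ->]; apply/zspanP; exists [ffun j => (j == i)%:R].
rewrite (bigD1 i) //= big1 => [|j /negPf ji]; last by rewrite ffunE ji mulr0z.
by rewrite ffunE eqxx mulr1z addr0 (tnth_nth 0).
Qed.

Lemma zspan_sub (S : zmodClosed vT) : {subset s <= S} -> {subset zspan s <= S}.
Proof.
move=> sS v /zspanP[a ->]; apply: rpred_sum => i _.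
by rewrite rpredMz // sS // mem_nth // size_tuple.
Qed.

End ZSpan.

(* Q[x, 1/x]/(x^n - 1) = Q[x]/(x^n - 1) for n >= 1, x being invertible in the
   latter; qx ^ v below is the power with an integer exponent v. *)
Definition QC (n : nat) : Type := {poly %/ ('X^n - 1 : {poly rat})}.
HB.instance Definition _ (n : nat) := GRing.ComUnitAlgebra.on (QC n).
HB.instance Definition _ (n : nat) := Vector.on (QC n).

Definition qx (n : nat) : QC n := 'qX.

Definition ev (n : nat) (v : int) : QC n := qx n ^ v - 1.

Definition epsv (n : nat) (d v : int) : QC n := ev n v *~ d - ev n (d * v).

(* Only used for `|d| >= 2, so the second branch is the case d <= -2. *)
Definition fv (n : nat) (d v : int) : QC n :=
  if 2 <= d then qx n ^ v *~ d - \sum_(0 <= i < `|d|) qx n ^ (d * v + i%:Z)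
  else qx n ^ v *~ d + \sum_(0 <= i < `|d|) qx n ^ (d * (v + 1) + i%:Z).

(* The tuple (g 1, ..., g (n - 1)). *)
Definition family1 (n : nat) (g : int -> QC n) : n.-1.-tuple (QC n) :=
  [tuple g (val i).+1%:Z | i < n.-1].

Record Zn (n : nat) : predArgType :=
  MkZn { Zn_val :> QC n; _ : Zn_val \in zspan (family1 (ev n)) }.
HB.instance Definition _ (n : nat) := [isSub for @Zn_val n].
HB.instance Definition _ (n : nat) := [Choice of Zn n by <:].
HB.instance Definition _ (n : nat) := [SubChoice_isSubZmodule of Zn n by <:].

(* The subgroup of Zn cut out by a Z-span; for the two families used here the
   whole span is contained in Zn, see epsv_zspan_sub and fv_zspan_sub. *)
Definition Zn_sub (n m : nat) (s : m.-tuple (QC n)) : {pred Zn n} :=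
  [pred z : Zn n | val z \in zspan s].

Fact Zn_sub_zmod_closed (n m : nat) (s : m.-tuple (QC n)) :
  zmod_closed (Zn_sub s).
Proof.
split=> [|u v]; rewrite !unfold_in /=; first exact: (rpred0 (zspan s)).
exact: (@rpredB _ (zspan s)).
Qed.
HB.instance Definition _ (n m : nat) (s : m.-tuple (QC n)) :=
  GRing.isZmodClosed.Build (Zn n) (Zn_sub s) (Zn_sub_zmod_closed s).

Definition Sigma (n : nat) (d : int) : zmodType :=
  Quotient.quot (Zn_sub (family1 (epsv n d))).

Definition Sand (n : nat) (d : int) : zmodType :=
  Quotient.quot (Zn_sub (family1 (fv n d))).

Definition Sigma_class (n : nat) (d : int) (z : Zn n) : Sigma n d :=
  \pi_(Quotient.quot (Zn_sub (family1 (epsv n d)))) z.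

Definition Sand_class (n : nat) (d : int) (z : Zn n) : Sand n d :=
  \pi_(Quotient.quot (Zn_sub (family1 (fv n d)))) z.

Lemma qx_expn (n : nat) : (0 < n)%N -> qx n ^+ n = 1.
Proof.
move=> n0; have mon : ('X^n - 1 : {poly rat}) \is monic.
  by rewrite -polyC1 monicXnsubC.
have hE : mk_monic ('X^n - 1 : {poly rat}) = 'X^n - 1.
  by rewrite /mk_monic mon -polyC1 size_XnsubC // ltnS n0.
apply/eqP; rewrite -subr_eq0; apply/eqP.
have -> : qx n ^+ n - 1 = in_qpoly ('X^n - 1 : {poly rat}) ('X^n - 1) :> QC n.
  by rewrite rmorphB rmorphXn rmorph1.
by apply: val_inj => /=; rewrite hE Pdiv.RingMonic.rmodpp.
Qed.

Lemma qx_unit (n : nat) : (0 < n)%N -> qx n \is a GRing.unit.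
Proof.
move=> n0; apply/unitrPr; exists (qx n ^+ n.-1).
by rewrite -exprS prednK // qx_expn.
Qed.

Lemma qx_modz (n : nat) (v : int) :
  (0 < n)%N -> qx n ^ v = qx n ^ (v %% n%:Z)%Z.
Proof.
move=> n0; rewrite {1}(divz_eq v n%:Z) exprzDr ?qx_unit // [_ * n%:Z]mulrC.
have -> : qx n ^ (n%:Z * (v %/ n%:Z)%Z) = 1.
  by rewrite -exprz_exp (_ : qx n ^ n%:Z = 1) ?exp1rz //; apply: qx_expn.
by rewrite mul1r.
Qed.

Lemma ev_zspan (n : nat) (v : int) :
  (0 < n)%N -> ev n v \in zspan (family1 (ev n)).
Proof.
move=> n0; rewrite /ev qx_modz //.
have : (0 <= v %% n%:Z)%Z by rewrite modz_ge0 // eqz_nat -lt0n.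
have : (v %% n%:Z)%Z < n%:Z by apply: ltz_pmod; rewrite ltz_nat.
case: (v %% n%:Z)%Z => // -[|k] ltkn _; first by rewrite expr0z subrr rpred0.
have ltk : (k < n.-1)%N by rewrite -ltnS prednK.
apply: mem_zspan; apply/tnthP; exists (Ordinal ltk).
by rewrite tnth_mktuple.
Qed.

Lemma epsv_zspan_sub (n : nat) (d : int) : (0 < n)%N ->
  {subset zspan (family1 (epsv n d)) <= zspan (family1 (ev n))}.
Proof.
move=> n0; apply: zspan_sub => _ /tnthP[i ->]; rewrite tnth_mktuple.
by rewrite rpredB ?rpredMz ?ev_zspan.
Qed.

Lemma fv_zspan_sub (n : nat) (d : int) : (0 < n)%N -> 2 <= `|d| ->
  {subset zspan (family1 (fv n d)) <= zspan (family1 (ev n))}.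
Proof.
move=> n0 d2; apply: zspan_sub => _ /tnthP[i ->]; rewrite tnth_mktuple /fv.
have sumE (g : nat -> int) : \sum_(0 <= i < `|d|) qx n ^ g i =
    \sum_(0 <= i < `|d|) ev n (g i) + 1 *~ `|d|%N.
  transitivity (\sum_(0 <= i < `|d|) (ev n (g i) + 1)).
    by apply: eq_bigr => j _; rewrite /ev subrK.
  by rewrite big_split /= big_const_nat subn0 iter_addr addr0.
have xE v : qx n ^ v *~ d = ev n v *~ d + 1 *~ d.
  by rewrite -mulrzDl /ev subrK.
rewrite !{}sumE !{}xE abszE; case: ifPn => hd.
  rewrite ger0_norm ?(le_trans _ hd) // opprD addrACA subrr addr0.
  by rewrite rpredB ?rpred_sum ?rpredMz ?ev_zspan // => j _; rewrite ev_zspan.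
have d0 : d <= 0 by move: d2 hd; case: (ger0P d) => [_ ->|/ltW].
rewrite ler0_norm // addrACA mulrNz subrr addr0.
by rewrite rpredD ?rpred_sum ?rpredMz ?ev_zspan // => j _; rewrite ev_zspan.
Qed.

Fact mulx1_zspan (n : nat) (c : Zn n) :
  (qx n - 1) * val c \in zspan (family1 (ev n)).
Proof.
case: c => _ /= /zspanP[a ->]; rewrite mulr_sumr rpred_sum // => i _.
have n0 : (0 < n)%N by case: (n) i => [[]|].
rewrite mulrzAr rpredMz // -tnth_nth tnth_mktuple.
set v := _%:Z.
have -> : (qx n - 1) * ev n v = ev n (v + 1) - ev n v - ev n 1.
  by rewrite /ev exprzDr ?qx_unit // expr1z; ring.
by do ![apply: rpredB; last exact: ev_zspan]; apply: ev_zspan.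
Qed.

Definition mulx1 (n : nat) (c : Zn n) : Zn n := MkZn (mulx1_zspan c).

Fact evsum_zspan (n : nat) (a : nat -> int) :
  \sum_(1 <= v < n) ev n v%:Z *~ a v \in zspan (family1 (ev n)).
Proof.
rewrite big_nat rpred_sum // => v /andP[_ ltvn].
by rewrite rpredMz // ev_zspan // (leq_ltn_trans _ ltvn).
Qed.

Definition evsum (n : nat) (a : nat -> int) : Zn n := MkZn (evsum_zspan n a).

(* Main.v *)
Require Import Defs.
From HB Require Import structures.
From mathcomp Require Import all_boot all_order all_algebra.
From mathcomp Require Import ring.

(** Multiplication by x - 1 sends f_v to eps_(v+1) - eps_v, for either sign of d.
    Let N = 1 + x + ... + x^(n-1).  On the kernel of x - 1, N acts as n, while N
    kills every e_v and every f_v; hence x - 1 is injective on Z_n, the f_v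
    (0 <= v < n) sum to 0, and (x - 1) c lies in the span of the eps_v exactly
    when c lies in the span of the f_v.  For the image, e_v = v e_1 modulo
    (x - 1) Z_n, so n e_1 is in (x - 1) Z_n, and e_v |-> v mod n kills both
    (x - 1) Z_n and the eps_v.  Finiteness: d^i = d^j mod n for some i <> j, so
    the nonzero integer d^i - d^j kills all generators of Sigma(n, d). *)

Import Order.TTheory GRing.Theory Num.Theory.
Local Open Scope ring_scope.
Local Open Scope quotient_scope.

(** As [m] kills every generator, coefficients may be reduced modulo [m], which leaves finitely many
    sums. *)
Lemma torsion_fin_gen (V : zmodType) (I : finType) (x : I -> V) (m : int) :
    m != 0 -> (forall i, x i *~ m = 0) ->
    (forall z, exists a : I -> int, z = \sum_i x i *~ a i) ->
  exists s : seq V, forall z, z \in s.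
Proof.
move=> m0 xm gen.
exists [seq \sum_i x i *+ (val (g i)) | g : {ffun I -> 'I_`|m|}] => z.
have [a ->] := gen z.
have ltm i : (`|(a i %% m)%Z| < `|m|)%N.
  by rewrite -ltz_nat gez0_abs ?modz_ge0 // abszE ltz_mod.
apply/codomP; exists [ffun i => Ordinal (ltm i)]; apply: eq_bigr => i _.
rewrite ffunE /= {1}(divz_eq (a i) m) mulrzDr mulrC mulrzA xm mul0rz add0r.
by rewrite -[in LHS](gez0_abs (modz_ge0 (a i) m0)).
Qed.

(** * Reduction of exponents mod n and the action of x - 1 *)

Section ZSpanFacts.

Variable n : nat.
Hypothesis n0 : (0 < n)%N.

Local Notation x := (qx n).

Lemma qxD v w : x ^ (v + w) = x ^ v * x ^ w.
Proof. by rewrite exprzDr ?qx_unit. Qed.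

Lemma ev_modz v : ev n v = ev n (v %% n%:Z)%Z.
Proof. by rewrite /ev qx_modz. Qed.

Lemma epsv_modz d v : epsv n d v = epsv n d (v %% n%:Z)%Z.
Proof.
rewrite /epsv -ev_modz; congr (_ - _).
by rewrite ev_modz [in RHS]ev_modz modzMmr.
Qed.

Lemma epsv0 d : epsv n d 0 = 0.
Proof. by rewrite /epsv mulr0 /ev expr0z subrr mul0rz subrr. Qed.

Lemma mem_family1 (g : int -> QC n) (v : nat) :
  (0 < v < n)%N -> g v \in zspan (family1 g).
Proof.
case: v => // v /= ltvn.
have ltv : (v < n.-1)%N by rewrite -ltnS prednK.
apply: mem_zspan; apply/tnthP; exists (Ordinal ltv).
by rewrite tnth_mktuple.
Qed.

Lemma nth_family1 (g : int -> QC n) (i : 'I_n.-1) :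
  (family1 g)`_i = g i.+1%:Z.
Proof. by rewrite -tnth_nth tnth_mktuple. Qed.

(** The index only matters mod n, and the index 0, missing from the family, contributes 0. *)
Lemma epsv_zspan d v : epsv n d v \in zspan (family1 (epsv n d)).
Proof.
rewrite epsv_modz.
have : (0 <= v %% n%:Z)%Z by rewrite modz_ge0 // eqz_nat -lt0n.
have : (v %% n%:Z)%Z < n%:Z by apply: ltz_pmod; rewrite ltz_nat.
case: (v %% n%:Z)%Z => // -[|k] ltkn _; first by rewrite epsv0 rpred0.
exact: mem_family1.
Qed.

Lemma geom_qx w (k : nat) :
  (x - 1) * \sum_(0 <= i < k) x ^ (w + i%:Z) = x ^ (w + k%:Z) - x ^ w.
Proof.
rewrite mulr_sumr -[in RHS](addr0 w) -addrA add0r.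
rewrite -(telescope_sumr (fun i : nat => x ^ (w + i%:Z))) //.
apply: eq_bigr => i _; rewrite -addn1 PoszD addrA [x ^ (_ + 1)]qxD expr1z.
by ring.
Qed.

Lemma mulx1_fv d v : 2 <= `|d| ->
  (x - 1) * fv n d v = epsv n d (v + 1) - epsv n d v.
Proof.
move=> d2; have xS : x ^ (v + 1) = x ^ v * x by rewrite qxD expr1z.
rewrite /fv; case: ifPn => hd.
  rewrite mulrBr geom_qx gez0_abs ?(le_trans _ hd) //.
  by rewrite /epsv /ev mulrDr mulr1 xS; ring.
have d0 : d <= 0 by move: d2 hd; case: (ger0P d) => [_ ->|/ltW].
rewrite mulrDr geom_qx lez0_abs //.
(* For negative [d] the geometric sum runs from d(v + 1) up to d(v + 1) + |d| = dv. *)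
rewrite [d * (v + 1)]mulrDr mulr1 addrK.
by rewrite /epsv /ev xS [d * (v + 1)]mulrDr mulr1; ring.
Qed.

(** * The norm element and injectivity of multiplication by x - 1 *)

Definition norm_elt : QC n := \sum_(i < n) x ^+ i.
Local Notation N := norm_elt.

Lemma norm_eltM v : N * x ^ v = N.
Proof.
have NE : N * (x - 1) = 0 by rewrite mulrC -subrX1 qx_expn ?subrr.
have Nx : N * x = N.
  by apply/eqP; rewrite -subr_eq0 -[X in _ - X]mulr1 -mulrBr NE.
rewrite qx_modz //.
have : (0 <= v %% n%:Z)%Z by rewrite modz_ge0 // eqz_nat -lt0n.
case: (v %% n%:Z)%Z => // k _.
by elim: k => [|k IH]; rewrite ?mulr1 // exprSz mulrA Nx.
Qed.

Lemma norm_elt_ev u : u \in zspan (family1 (ev n)) -> N * u = 0.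
Proof.
case/zspanP => a ->; rewrite mulr_sumr big1 // => i _.
by rewrite mulrzAr nth_family1 mulrBr norm_eltM mulr1 subrr mul0rz.
Qed.

(** N only sees the sum of the coefficients, here d - |d| or d + |d| according to the sign of d. *)
Lemma norm_elt_fv d v : 2 <= `|d| -> N * fv n d v = 0.
Proof.
move=> d2.
have sumE (g : nat -> int) : N * \sum_(0 <= i < `|d|) x ^ g i = N *~ `|d|%N.
  rewrite mulr_sumr (eq_bigr (fun=> N)) => [|i _]; last exact: norm_eltM.
  by rewrite big_const_nat subn0 iter_addr addr0.
rewrite /fv; case: ifPn => hd.
  rewrite mulrBr sumE mulrzAr norm_eltM gez0_abs ?subrr //.
  exact: le_trans hd.
have d0 : d <= 0 by move: d2 hd; case: (ger0P d) => [_ ->|/ltW].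
by rewrite mulrDr sumE mulrzAr norm_eltM lez0_abs // mulrNz subrr.
Qed.

(* On the kernel of x - 1 the norm element acts as multiplication by n. *)
Lemma mulx1_eq0 u : N * u = 0 -> (x - 1) * u = 0 -> u = 0.
Proof.
move=> Nu0 xu0.
have xu : x * u = u.
  by apply/eqP; rewrite -subr_eq0 -[X in _ - X]mul1r -mulrBl xu0.
have xiu i : x ^+ i * u = u.
  by elim: i => [|i IH]; rewrite ?mul1r // exprSr -mulrA xu.
move: Nu0; rewrite mulr_suml (eq_bigr (fun=> u)) => [|i _]; last exact: xiu.
rewrite sumr_const card_ord -scaler_nat => /eqP.
by rewrite scaler_eq0 pnatr_eq0 eqn0Ngt n0 /= => /eqP.
Qed.

Lemma sum_fv d : 2 <= `|d| -> \sum_(0 <= v < n) fv n d v%:Z = 0.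
Proof.
move=> d2; apply: mulx1_eq0.
  by rewrite mulr_sumr big1 // => v _; rewrite norm_elt_fv.
rewrite mulr_sumr.
rewrite (eq_bigr (fun v : nat => epsv n d v.+1%:Z - epsv n d v%:Z)); last first.
  by move=> v _; rewrite mulx1_fv // -addn1 PoszD.
rewrite (telescope_sumr (fun v : nat => epsv n d v%:Z)) //.
by rewrite epsv_modz modzz epsv0 subrr.
Qed.

(** Only f_0 is not a generator; by [sum_fv] it is minus the sum of the others. *)
Lemma fv_zspan d (v : nat) : 2 <= `|d| -> (v < n)%N ->
  fv n d v%:Z \in zspan (family1 (fv n d)).
Proof.
move=> d2; case: v => [|v] ltvn; last exact: mem_family1.
have /eqP := sum_fv d d2; rewrite big_ltn // addr_eq0 => /eqP ->.
rewrite rpredN big_nat rpred_sum // => v v_lt; exact: mem_family1.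
Qed.

(** One direction makes the map on quotients well defined, the other makes it injective. *)
Lemma mulx1_fv_zspan d c : 2 <= `|d| -> c \in zspan (family1 (ev n)) ->
  ((x - 1) * c \in zspan (family1 (epsv n d))) =
  (c \in zspan (family1 (fv n d))).
Proof.
move=> d2 cZ; apply/idP/idP => [/zspanP[b bE]|/zspanP[b ->]]; last first.
  rewrite mulr_sumr; apply: rpred_sum => i _.
  rewrite mulrzAr nth_family1 (mulx1_fv _ _ d2).
  by apply/rpredMz/rpredB; apply: epsv_zspan.
(* Since eps_0 = 0, telescoping gives eps_v = (x - 1)(f_0 + ... + f_(v-1)), so [w] has the same
   image as [c]; N kills both, hence they agree. *)
pose w := \sum_(i < n.-1) (\sum_(0 <= j < i.+1) fv n d j%:Z) *~ b i.
suff -> : c = w.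
  apply: rpred_sum => i _; apply/rpredMz; rewrite big_nat.
  apply: rpred_sum => j /andP[_ ltj]; apply: fv_zspan => //.
  by rewrite (leq_trans ltj) // (leq_trans (ltn_ord i)) // leq_pred.
apply/eqP; rewrite -subr_eq0; apply/eqP/mulx1_eq0.
  rewrite mulrBr norm_elt_ev // sub0r; apply/eqP; rewrite oppr_eq0; apply/eqP.
  rewrite mulr_sumr big1 // => i _; rewrite mulrzAr mulr_sumr.
  by rewrite big1 ?mul0rz // => j _; rewrite norm_elt_fv.
rewrite mulrBr bE mulr_sumr -sumrB big1 // => i _.
rewrite mulrzAr nth_family1 -mulrzBl mulr_sumr.
rewrite (eq_bigr (fun v : nat => epsv n d v.+1%:Z - epsv n d v%:Z)); last first.
  by move=> v _; rewrite mulx1_fv // -addn1 PoszD.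
rewrite (telescope_sumr (fun v : nat => epsv n d v%:Z)) //.
by rewrite epsv0 subr0 subrr mul0rz.
Qed.

(** * The e_v modulo (x - 1) Z_n, and modulo the span of the eps_v *)

Lemma mulx1_ev v : (x - 1) * ev n v = ev n (v + 1) - ev n v - ev n 1.
Proof. by rewrite /ev qxD expr1z; ring. Qed.

(** An explicit form of e_v = v e_1 modulo (x - 1) Z_n, obtained by summing [mulx1_ev]. *)
Lemma ev_decomp (v : nat) :
  ev n v = (x - 1) * (\sum_(0 <= j < v) ev n j%:Z) + ev n 1 *~ v%:Z.
Proof.
elim: v => [|v IH]; first by rewrite big_geq // mulr0 /ev subrr mulr0z addr0.
rewrite big_nat_recr //= mulrDr mulx1_ev -addn1 PoszD mulrzDr.
by rewrite {1}IH; ring.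
Qed.

(* A power d ^+ k acts on the classes of the e_v as v |-> d ^+ k * v, and
   d ^+ i, d ^+ j are congruent mod n for some i != j. *)
Lemma ev_torsion d : 2 <= `|d| -> exists2 m : int, m != 0 &
  forall v, ev n v *~ m \in zspan (family1 (epsv n d)).
Proof.
move=> d2.
have powP k v : ev n v *~ d ^+ k - ev n (d ^+ k * v) \in
    zspan (family1 (epsv n d)).
  elim: k v => [|k IH] v; first by rewrite mul1r mulr1z subrr rpred0.
  have -> : ev n v *~ d ^+ k.+1 - ev n (d ^+ k.+1 * v) =
     epsv n d v *~ d ^+ k + (ev n (d * v) *~ d ^+ k - ev n (d ^+ k * (d * v))).
    by rewrite /epsv exprSr -mulrA; ring.
  by rewrite rpredD ?rpredMz ?epsv_zspan.
have ltdn (i : 'I_n.+1) : (`|(d ^+ i %% n%:Z)%Z| < n)%N.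
  rewrite -ltz_nat gez0_abs ?modz_ge0 ?ltz_pmod ?ltz_nat //.
  by rewrite eqz_nat -lt0n.
have [inj|] := boolP (injectiveb (fun i : 'I_n.+1 => Ordinal (ltdn i))).
  by have := leq_card _ (injectiveP _ inj); rewrite !card_ord ltnn.
case/injectivePn => i [j ij [eq_ij]].
exists (d ^+ i - d ^+ j) => [|v].
  rewrite subr_eq0; apply: contraNneq ij => dij; apply/eqP/val_inj.
  (* As |d| > 1, distinct exponents give distinct powers, so the difference is nonzero. *)
  have d1 : (1 < `|d|)%N by rewrite -ltz_nat abszE (lt_le_trans _ d2).
  by apply: (expnI d1); rewrite /= -!abszX dij.
have -> : ev n v *~ (d ^+ i - d ^+ j) =
   (ev n v *~ d ^+ i - ev n (d ^+ i * v)) -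
   (ev n v *~ d ^+ j - ev n (d ^+ j * v)).
  have -> : ev n (d ^+ i * v) = ev n (d ^+ j * v).
    rewrite ev_modz [RHS]ev_modz -modzMml -[in RHS]modzMml.
    congr (ev n (_ * _ %% _)%Z).
    have nz : n%:Z != 0 by rewrite eqz_nat -lt0n.
    by rewrite -(gez0_abs (modz_ge0 (d ^+ i) nz)) eq_ij gez0_abs ?modz_ge0.
  by ring.
by rewrite rpredB.
Qed.

End ZSpanFacts.

(** * The weight mod n, an obstruction to lying in the image *)

(* The derivative at 1 of the reduced representative: as a functional on Q[C_n]
   it sends e_v to v mod n. *)
Definition weight n (u : QC n) : rat := (polyn u)^`().[1].

Fact weight_is_zmod_morphism n : zmod_morphism (@weight n).
Proof. by move=> u v; rewrite /weight /= derivB hornerD hornerN. Qed.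
HB.instance Definition _ n :=
  GRing.isZmodMorphism.Build (QC n) rat (@weight n) (@weight_is_zmod_morphism n).

Lemma weight_ev n v : (0 < n)%N -> weight n (ev n v) = (v %% n%:Z)%Z%:~R.
Proof.
move=> n0; rewrite ev_modz //.
have : (0 <= v %% n%:Z)%Z by rewrite modz_ge0 // eqz_nat -lt0n.
have : (v %% n%:Z)%Z < n%:Z by apply: ltz_pmod; rewrite ltz_nat.
case: (v %% n%:Z)%Z => // k ltkn _.
have hE : mk_monic ('X^n - 1 : {poly rat}) = 'X^n - 1.
  by rewrite /mk_monic -polyC1 size_XnsubC // ltnS n0 monicXnsubC.
have -> : ev n k = in_qpoly ('X^n - 1 : {poly rat}) ('X^k - 1) :> QC n.
  by rewrite rmorphB rmorphXn rmorph1.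
(* X^k - 1 has degree below n, so it is already reduced; it vanishes when k = 0, hence the case
   split. *)
rewrite /weight in_qpoly_small ?hE; last first.
  rewrite -polyC1 [size ('X^n - _)]size_XnsubC // ltnS; case: k ltkn => [|k] ltkn.
    by rewrite subrr size_poly0.
  by rewrite size_XnsubC.
by rewrite derivB derivXn -polyC1 derivC subr0 hornerMn hornerXn expr1n.
Qed.

(** Weights are rational, so divisibility by n is expressed as integrality of the quotient. *)
Definition weight_dvd n : {pred QC n} :=
  [pred u | weight n u / n%:R \is a Num.int].

Fact weight_dvd_zmod_closed n : zmod_closed (weight_dvd n).
Proof.
split=> [|u v]; rewrite !inE /=; first by rewrite raddf0 mul0r.
by move=> uP vP; rewrite raddfB mulrBl rpredB.
Qed.
HB.instance Definition _ n :=
  GRing.isZmodClosed.Build (QC n) (weight_dvd n) (weight_dvd_zmod_closed n).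


Lemma ev_weight_dvd n v : (0 < n)%N ->
  (weight n (ev n v) - v%:~R) / n%:R \is a Num.int.
Proof.
move=> n0; rewrite weight_ev //.
have -> : v%:~R = (v %/ n%:Z)%Z%:~R * n%:R + (v %% n%:Z)%Z%:~R :> rat.
  by rewrite -[n%:R]/(n%:Z%:~R) -intrM -intrD -divz_eq.
rewrite opprD addrCA subrr addr0 mulNr mulfK ?pnatr_eq0 -?lt0n //.
by rewrite rpredN intr_int.
Qed.

Lemma mulx1_weight_dvd n c : (0 < n)%N ->
  c \in zspan (family1 (ev n)) -> (qx n - 1) * c \in weight_dvd n.
Proof.
move=> n0 /zspanP[a ->]; rewrite mulr_sumr; apply: rpred_sum => i _.
rewrite mulrzAr nth_family1 mulx1_ev //; apply: rpredMz.
set v := _%:Z; rewrite inE /= 2!raddfB.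
(* The inserted integers cancel, (v + 1) - v - 1 = 0, and each remaining bracket is a multiple of
   n. *)
have -> : weight n (ev n (v + 1)) - weight n (ev n v) - weight n (ev n 1) =
  (weight n (ev n (v + 1)) - (v + 1)%:~R) - (weight n (ev n v) - v%:~R) -
  (weight n (ev n 1) - 1%:~R) by ring.
by rewrite 2!mulrBl !rpredB ?ev_weight_dvd.
Qed.

Lemma epsv_weight_dvd n d : (0 < n)%N ->
  {subset zspan (family1 (epsv n d)) <= weight_dvd n}.
Proof.
move=> n0; apply: zspan_sub => _ /tnthP[i ->]; rewrite tnth_mktuple.
set v := _%:Z; rewrite inE /= raddfB raddfMz /=.
have -> : weight n (ev n v) *~ d - weight n (ev n (d * v)) =
  (weight n (ev n v) - v%:~R) *~ d - (weight n (ev n (d * v)) - (d * v)%:~R).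
  by ring.
by rewrite mulrBl mulrzAl rpredB ?rpredMz ?ev_weight_dvd.
Qed.

Lemma evsum_weight n a : (0 < n)%N ->
  weight n (evsum n a : QC n) = (\sum_(1 <= v < n) v%:Z * a v)%:~R.
Proof.
move=> n0; rewrite /= !raddf_sum /= !big_nat; apply: eq_bigr => v /andP[_ ltvn].
rewrite raddfMz /= weight_ev // modz_small ?ltz_nat // intrM.
by rewrite -mulrzr.
Qed.

Lemma evsum_mulx1P n a : (0 < n)%N ->
  (\sum_(1 <= v < n) v%:Z * a v = 0 %[mod n%:Z])%Z ->
  exists c : Zn n, evsum n a = mulx1 c.
Proof.
move=> n0 /eqP; rewrite eqz_mod_dvd subr0 => /dvdzP[k kE].
pose s (v : nat) := \sum_(0 <= j < v) ev n j%:Z.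
have sZ v : s v \in zspan (family1 (ev n)).
  by apply: rpred_sum => j _; apply: ev_zspan.
(* By [ev_decomp], a = (x - 1) sum_v a_v s_v + (k n) e_1, and the case v = n, where e_n = 0, gives n
   e_1 = -(x - 1) s_n. *)
have cZ : \sum_(1 <= v < n) s v *~ a v - s n *~ k \in zspan (family1 (ev n)).
  by apply: rpredB; [apply: rpred_sum => v _|]; apply: rpredMz.
exists (MkZn cZ); apply: val_inj => /=.
have evnn : ev n n%:Z = 0 by rewrite ev_modz // modzz /ev subrr.
have := ev_decomp n n0 n; rewrite evnn -/(s n) => /esym/eqP.
rewrite addr_eq0 => /eqP snE.
rewrite mulrBr mulrzAr snE mulNrz opprK -mulrzA [n%:Z * k]mulrC -kE.
rewrite mulr_sumr mulrz_sumr -big_split /=; apply: eq_bigr => v _.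
by rewrite {1}ev_decomp // -/(s v) mulrzDl mulrzAr -mulrzA.
Qed.

(** * Classes in the two quotient groups *)

Lemma Sigma_classP n d (u v : Zn n) :
  (Sigma_class d u = Sigma_class d v) <->
  (val u - val v \in zspan (family1 (epsv n d))).
Proof.
have -> : (val u - val v \in zspan (family1 (epsv n d))) =
  (u - v \in Zn_sub (family1 (epsv n d))) by rewrite unfold_in.
by rewrite Quotient.idealrBE; split=> /eqP.
Qed.

Lemma Sand_classP n d (u v : Zn n) :
  (Sand_class d u = Sand_class d v) <->
  (val u - val v \in zspan (family1 (fv n d))).
Proof.
have -> : (val u - val v \in zspan (family1 (fv n d))) =
  (u - v \in Zn_sub (family1 (fv n d))) by rewrite unfold_in.
by rewrite Quotient.idealrBE; split=> /eqP.
Qed.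

Fact Sigma_class_is_zmod_morphism n d : zmod_morphism (@Sigma_class n d).
Proof. by move=> u v; rewrite /Sigma_class !piE. Qed.
HB.instance Definition _ n d :=
  GRing.isZmodMorphism.Build (Zn n) (Sigma n d) (@Sigma_class n d)
    (@Sigma_class_is_zmod_morphism n d).

Fact Sand_class_is_zmod_morphism n d : zmod_morphism (@Sand_class n d).
Proof. by move=> u v; rewrite /Sand_class !piE. Qed.
HB.instance Definition _ n d :=
  GRing.isZmodMorphism.Build (Zn n) (Sand n d) (@Sand_class n d)
    (@Sand_class_is_zmod_morphism n d).

Lemma Sigma_class_surj n d (z : Sigma n d) : exists u, z = Sigma_class d u.
Proof. by exists (repr z); rewrite /Sigma_class reprK. Qed.

Lemma Sand_class_surj n d (y : Sand n d) : exists u, y = Sand_class d u.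
Proof. by exists (repr y); rewrite /Sand_class reprK. Qed.

(** * Finiteness, the embedding and its image *)

Lemma Sigma_finite n d : (0 < n)%N -> 2 <= `|d| ->
  exists s : seq (Sigma n d), forall z, z \in s.
Proof.
move=> n0 d2; have [m m0 mP] := ev_torsion n n0 d d2.
pose e (i : 'I_n.-1) : Zn n := MkZn (ev_zspan i.+1%:Z n0).
apply: (@torsion_fin_gen _ _ (fun i => Sigma_class d (e i)) m) => // [i|z].
  rewrite -raddfMz -[RHS](raddf0 (@Sigma_class n d)).
  by apply/Sigma_classP; rewrite -raddfB subr0 raddfMz; apply: mP.
have [[u uZ] ->] := Sigma_class_surj n d z; have /zspanP[a uE] := uZ.
exists a; under eq_bigr do rewrite -raddfMz.
rewrite -raddf_sum; congr Sigma_class; apply: val_inj.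
rewrite raddf_sum [LHS]uE; apply: eq_bigr => i _.
by rewrite raddfMz nth_family1.
Qed.

Theorem theorem2p5 (n : nat) (d : int) (n_gt0 : (1 <= n)%N)
    (d_ge2 : 2 <= `|d|) :
  (exists s : seq (Sigma n d), forall z : Sigma n d, z \in s) /\
  exists phi : {additive Sand n d -> Sigma n d},
    [/\ forall c : Zn n, phi (Sand_class d c) = Sigma_class d (mulx1 c),
        injective phi
      & forall a : nat -> int,
          (exists y : Sand n d, phi y = Sigma_class d (evsum n a)) <->
          (\sum_(1 <= v < n) v%:Z * a v = 0 %[mod n%:Z])%Z].
Proof.
split; first exact: Sigma_finite.
(* The choice of representative is harmless by [mulx1P], whose converse direction is injectivity. *)
pose f (y : Sand n d) : Sigma n d := Sigma_class d (mulx1 (repr y)).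
have mulx1P (b c : Zn n) :
    Sigma_class d (mulx1 b) = Sigma_class d (mulx1 c) <->
    Sand_class d b = Sand_class d c.
  rewrite Sigma_classP Sand_classP /= -mulrBr mulx1_fv_zspan //.
  by apply: rpredB; apply: valP.
have fE c : f (Sand_class d c) = Sigma_class d (mulx1 c).
  by apply/mulx1P; rewrite /Sand_class reprK.
have f_add : zmod_morphism f.
  move=> y z; have [b ->] := Sand_class_surj n d y.
  have [c ->] := Sand_class_surj n d z; rewrite -raddfB !fE -raddfB.
  by congr Sigma_class; apply: val_inj; rewrite /= mulrBr.
pose phi : {additive Sand n d -> Sigma n d} :=
  HB.pack f (GRing.isZmodMorphism.Build _ _ f f_add).
exists phi; split=> [||a]; first exact: fE.
  move=> y z; have [b ->] := Sand_class_surj n d y.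
  have [c ->] := Sand_class_surj n d z.
  by rewrite /= !fE => /mulx1P.
split=> [[y]|/(evsum_mulx1P n a n_gt0)[c ->]]; last first.
  by exists (Sand_class d c); apply: fE.
have [c ->] := Sand_class_surj n d y; rewrite /= fE => /Sigma_classP.
(* The element a differs from (x - 1) c by a combination of the eps_v; both have weight divisible by
   n, hence so does a. *)
move=> /(epsv_weight_dvd n d n_gt0) hw.
have : val (evsum n a) \in weight_dvd n.
  have -> : val (evsum n a) = val (mulx1 c) - (val (mulx1 c) - val (evsum n a)).
    by rewrite opprB addrCA subrr addr0.
  by apply: rpredB hw; apply: mulx1_weight_dvd => //; apply: valP.
rewrite inE /= evsum_weight // => /intrP[k kE]; apply/eqP.
rewrite eqz_mod_dvd subr0; apply/dvdzP; exists k.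
apply/eqP; rewrite -(eqr_int rat) intrM -kE divfK //.
by rewrite pnatr_eq0 -lt0n.
Qed.
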